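(* Let $\tau>0$, $k>0$ and let $N\ge 1$ be an integer. Assume that $u\in\mathcal{C}^2([0,\tau])$ is real-valued and $u(0)=0$. Let $y(t)=ku(t)$ and $y_N(t)=(K_Nu)(t)$. Then, for all $t\in[0,\tau]$, $$|y(t)-y_N(t)|\le \frac{2k\tau}{\pi^2N}\left(|\dot u(t)|+|\dot u(0)|+\|\ddot u\|_{L_1[0,t]}\right).$$
   Context: Let $\omega_0=\pi/\tau$ and $$\kappa_N(t)=\frac{k}{2\tau}+\sum_{l=1}^N\frac{k}{\tau}\cos(l\omega_0t),$$ and let $\kappa_N^c$ denote its causal part: $\kappa_N^c(t)=\kappa_N(t)$ for $t\ge 0$ and $\kappa_N^c(t)=0$ for $t<0$. The linear operator $K_N$ is defined by $$(K_Nu)(t)=\int_0^t 2\kappa_N^c(t-s)u(s)\,ds,\qquad t\in[0,\tau].$$ Dots denote derivatives with respect to time. *)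

(* Defs.v *)
(* Stdlib reals with Coquelicot. *)
From Stdlib Require Import Reals.
From Coquelicot Require Import Coquelicot.
Open Scope R_scope.

(* Derivative of f at x relative to D; at an endpoint of D = [a,b] this is the
   one-sided derivative, and values of f outside D play no role. *)
Definition is_derive_within (D : R -> Prop) (f : R -> R) (x l : R) : Prop :=
  filterdiff f (within D (locally x)) (fun h => scal h l).

(* f is of class C^2 on [a,b], with first and second derivatives f1 and f2
   there. Continuity of f and f1 follows from differentiability; f1 and f2 are
   determined on [a,b] by f when a < b. *)
Definition is_C2_on (a b : R) (f f1 f2 : R -> R) : Prop :=
  (forall x, a <= x <= b ->
     is_derive_within (fun s => a <= s <= b) f x (f1 x) /\
     is_derive_within (fun s => a <= s <= b) f1 x (f2 x)) /\
  continuous_on (fun s => a <= s <= b) f2.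

Definition omega0 (tau : R) : R := PI / tau.

Definition kappa (tau k : R) (N : nat) (t : R) : R :=
  k / (2 * tau) +
  sum_n_m (fun l => k / tau * cos (INR l * omega0 tau * t)) 1 N.

Definition causal (f : R -> R) (t : R) : R :=
  if Rle_dec 0 t then f t else 0.

Definition K_op (tau k : R) (N : nat) (u : R -> R) (t : R) : R :=
  RInt (fun s => 2 * causal (kappa tau k N) (t - s) * u s) 0 t.

(* Used only for f continuous on [a,b], where the Riemann and Lebesgue
   integrals of |f| coincide. *)
Definition L1_norm (a b : R) (f : R -> R) : R :=
  RInt (fun s => Rabs (f s)) a b.

(* Main.v *)
Require Import Defs.
From Stdlib Require Import Reals Lra Lia.
From Coquelicot Require Import Coquelicot.
Open Scope R_scope.

(** The kernel of [K_N] is [2 * kappa_N], a scaled Dirichlet kernel, and on the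
    half period [0, tau] it acts on functions of [s <= t] as an approximate
    delta of mass [k] concentrated at [s = t].  The error is found by
    integrating this kernel twice.

    With [x = omega0 * (t - s)] in [0, PI], let [D_N = 1/2 + sum cos (l x)]
    (sums over [1 <= l <= N]), let [S_N = (PI - x)/2 - sum sin (l x) / l], and
    let [F_N = sum cos (l x) / l^2 - x^2/4 + PI x / 2].  Then [F_N' = S_N] and
    [S_N' = - D_N].  Rescaling, put [Phi (x) = (2k/PI) S_N (omega0 x)] and
    [Psi (x) = (2 k tau / PI^2) (F_N (omega0 x) - C)], so that
    [Psi' = Phi], [Phi' = - 2 kappa_N] and [Phi 0 = k].  Hence
    [Phi (t - s) u (s) + Psi (t - s) u' (s)] has derivative
    [2 kappa_N (t - s) u (s) + Psi (t - s) u'' (s)] in [s], and integrating from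
    0 to t, with [u 0 = 0], gives ([error_representation])
      [k u(t) - (K_N u)(t)
         = int_0^t Psi(t-s) u''(s) ds - Psi(0) u'(t) + Psi(t) u'(0)].
    The estimate follows once [|Psi| <= 2 k tau / (PI^2 N)] on [0, tau].

    That bound says [|F_N - C| <= 1/N] on [0, PI] for a suitable constant [C]
    ([parabola_fourier_remainder]).  Consecutive [F_N] differ by a term of size
    at most [1/l^2], which telescopes to a tail of at most [1/N]; what remains
    is that the pointwise limit of [F_N] is constant, that is, the Fourier
    series of the parabola.  On [d, PI] with [d > 0] this holds because
    [S_N -> 0] uniformly there, and uniform convergence of [F_N] carries the
    constancy to [x = 0]. *)

(** * Fourier remainders of the sawtooth and the parabola *)

(** Side goals about derivatives are equations in the carrier of a normed module;
    [ring] and [field] work once that carrier is displayed as [R]. *)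
Ltac eqR := match goal with |- @eq _ ?a ?b => change (@eq R a b) end.

Definition dirichlet (N : nat) (x : R) : R :=
  1 / 2 + sum_n_m (fun l => cos (INR l * x)) 1 N.

Definition sawtooth_err (N : nat) (x : R) : R :=
  (PI - x) / 2 - sum_n_m (fun l => sin (INR l * x) / INR l) 1 N.

Definition parabola_err (N : nat) (x : R) : R :=
  sum_n_m (fun l => cos (INR l * x) / INR l ^ 2) 1 N - x ^ 2 / 4 + PI * x / 2.

Lemma sum_n_m_1_S (a : nat -> R) (N : nat) :
  sum_n_m a 1 (S N) = sum_n_m a 1 N + a (S N).
Proof. rewrite sum_n_Sm; [reflexivity | lia]. Qed.

Lemma is_derive_sum_1 (f df : nat -> R -> R) (N : nat) (x : R) :
  (forall l, (1 <= l)%nat -> is_derive (f l) x (df l x)) ->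
  is_derive (fun y => sum_n_m (fun l => f l y) 1 N) x
    (sum_n_m (fun l => df l x) 1 N).
Proof.
  intros Hf; induction N as [|N IH].
  - rewrite sum_n_m_zero by lia.
    apply is_derive_ext with (fun _ => 0).
    + intros y; rewrite sum_n_m_zero by lia; reflexivity.
    + apply (is_derive_const (V := R_NormedModule) 0).
  - rewrite sum_n_m_1_S.
    apply is_derive_ext with (fun y => sum_n_m (fun l => f l y) 1 N + f (S N) y).
    + intros y; rewrite sum_n_m_1_S; reflexivity.
    + apply (is_derive_plus (V := R_NormedModule)); [exact IH | apply Hf; lia].
Qed.

Lemma is_derive_parabola_err (N : nat) (x : R) :
  is_derive (parabola_err N) x (sawtooth_err N x).
Proof.
  assert (Hs : is_derive (fun y => sum_n_m (fun l => cos (INR l * y) / INR l ^ 2) 1 N) x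
    (sum_n_m (fun l => (-1) * (sin (INR l * x) / INR l)) 1 N)).
  { apply (is_derive_sum_1 (fun l y => cos (INR l * y) / INR l ^ 2)
             (fun l y => (-1) * (sin (INR l * y) / INR l))).
    intros l Hl.
    assert (INR l <> 0) by (apply not_0_INR; lia).
    auto_derive; [trivial | eqR; field; assumption]. }
  assert (E : sum_n_m (fun l => (-1) * (sin (INR l * x) / INR l)) 1 N
            = (-1) * sum_n_m (fun l => sin (INR l * x) / INR l) 1 N)
    by apply (sum_n_m_mult_l (K := R_Ring)).
  rewrite E in Hs.
  unfold parabola_err, sawtooth_err.
  apply is_derive_ext with
    (fun y => sum_n_m (fun l => cos (INR l * y) / INR l ^ 2) 1 N
              + (- y ^ 2 / 4 + PI * y / 2)); [intros y; eqR; field|].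
  replace ((PI - x) / 2 - sum_n_m (fun l => sin (INR l * x) / INR l) 1 N)
    with (-1 * sum_n_m (fun l => sin (INR l * x) / INR l) 1 N + (PI - x) / 2) by ring.
  apply (is_derive_plus (V := R_NormedModule)); [exact Hs|].
  auto_derive; [trivial | eqR; field].
Qed.

Lemma is_derive_sawtooth_err (N : nat) (x : R) :
  is_derive (sawtooth_err N) x (- dirichlet N x).
Proof.
  assert (Hs : is_derive (fun y => sum_n_m (fun l => sin (INR l * y) / INR l) 1 N) x
    (sum_n_m (fun l => cos (INR l * x)) 1 N)).
  { apply (is_derive_sum_1 (fun l y => sin (INR l * y) / INR l)
             (fun l y => cos (INR l * y))).
    intros l Hl.
    assert (INR l <> 0) by (apply not_0_INR; lia).
    auto_derive; [trivial | eqR; field; assumption]. }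
  unfold sawtooth_err, dirichlet.
  replace (- (1 / 2 + sum_n_m (fun l => cos (INR l * x)) 1 N))
    with (- 1 / 2 - sum_n_m (fun l => cos (INR l * x)) 1 N) by field.
  apply (is_derive_minus (V := R_NormedModule)); [|exact Hs].
  auto_derive; [trivial | eqR; field].
Qed.

(** Each added cosine, multiplied by [2 sin (x/2)], is a difference of sines at
    consecutive half-integer frequencies, so the sum telescopes. *)
Lemma dirichlet_closed_form (N : nat) (x : R) :
  2 * sin (x / 2) * dirichlet N x = sin ((INR N + / 2) * x).
Proof.
  unfold dirichlet; induction N as [|N IH].
  - rewrite sum_n_m_zero by lia. simpl INR.
    change (@zero R_AbelianMonoid) with 0.
    replace ((0 + / 2) * x) with (x / 2) by field; field.
  - rewrite sum_n_m_1_S, <- Rplus_assoc, Rmult_plus_distr_l, IH, S_INR.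
    replace ((INR N + / 2) * x) with ((INR N + 1) * x - x / 2) by field.
    replace ((INR N + 1 + / 2) * x) with ((INR N + 1) * x + x / 2) by field.
    rewrite sin_minus, sin_plus; ring.
Qed.

Lemma increment_le (f df : R -> R) (a b K : R) :
  a <= b ->
  (forall x, a <= x <= b -> is_derive f x (df x)) ->
  (forall x, a <= x <= b -> Rabs (df x) <= K) ->
  Rabs (f b - f a) <= K * (b - a).
Proof.
  intros Hab Hd HK.
  destruct (MVT_gen f a b df) as [c [Hc E]];
    rewrite ?(Rmin_left _ _ Hab), ?(Rmax_right _ _ Hab) in *.
  - intros x Hx; apply Hd; lra.
  - intros x Hx; apply continuity_pt_filterlim.
    apply (ex_derive_continuous (V := R_NormedModule)).
    exists (df x); apply Hd; lra.
  - rewrite E, Rabs_mult, (Rabs_pos_eq (b - a)) by lra.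
    apply Rmult_le_compat_r; [lra | apply HK; lra].
Qed.

Lemma sin_INR_PI (l : nat) : sin (INR l * PI) = 0.
Proof. apply sin_eq_0_1; exists (Z.of_nat l); rewrite <- INR_IZR_INZ; reflexivity. Qed.

Lemma sawtooth_err_PI (N : nat) : sawtooth_err N PI = 0.
Proof.
  unfold sawtooth_err.
  rewrite (sum_n_m_ext_loc _ (fun _ => 0)).
  - rewrite sum_n_m_const; field.
  - intros l _; rewrite sin_INR_PI; apply Rdiv_0_l.
Qed.

Lemma Rabs_cos_le_1 (x : R) : Rabs (cos x) <= 1.
Proof. apply Rabs_le, COS_bound. Qed.

(** Away from 0 the error is [O(1/N)].  It is the integral from [x] to [PI] of
    [sin ((N+1/2) y) / (2 sin (y/2))]; one integration by parts gains the factor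
    [1/(N+1/2)], while the amplitude [1/sin (y/2)] and its derivative stay
    bounded by powers of [1/sin (d/2)]. *)
Lemma sawtooth_err_bound (N : nat) (d x : R) :
  0 < d -> d <= x <= PI ->
  Rabs (sawtooth_err N x) <= 3 / ((2 * INR N + 1) * sin (d / 2) ^ 2).
Proof.
  intros Hd Hx.
  pose proof PI_4 as HPI.
  pose proof (pos_INR N) as HN.
  set (n := 2 * INR N + 1); assert (Hn : 1 <= n) by (unfold n; lra).
  set (s := sin (d / 2)).
  assert (Hs : 0 < s) by (apply sin_gt_0; lra).
  assert (Hs1 : s <= 1) by apply SIN_bound.
  assert (Hmon : forall y, d <= y <= PI -> s <= sin (y / 2))
    by (intros y Hy; apply sin_incr_1; lra).
  (* h is the boundary term of the integration by parts: subtracting it from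
     the error leaves a derivative of size 1/N.  Both h and the error vanish
     at PI. *)
  set (h := fun y => cos ((INR N + / 2) * y) / (n * sin (y / 2))).
  set (dg := fun y => cos ((INR N + / 2) * y) * cos (y / 2) / (2 * n * sin (y / 2) ^ 2)).
  assert (Hder : forall y, x <= y <= PI ->
            is_derive (fun z => sawtooth_err N z - h z) y (dg y)).
  { intros y Hy.
    pose proof (Hmon y ltac:(lra)) as Hsy.
    replace (dg y) with (- dirichlet N y
      - (- sin ((INR N + / 2) * y) / (2 * sin (y / 2))
         - cos ((INR N + / 2) * y) * cos (y / 2) / (2 * n * sin (y / 2) ^ 2))).
    - apply (is_derive_minus (V := R_NormedModule)).
      + apply is_derive_sawtooth_err.
      + unfold h; auto_derive.
        * apply Rmult_integral_contrapositive; split; [lra|].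
          unfold Rdiv in Hsy; lra.
        * change (y * / 2) with (y / 2).
          unfold n in *; field; lra.
    - rewrite <- dirichlet_closed_form; unfold dg; field; lra. }
  assert (Hsq : 0 < s ^ 2) by (apply pow_lt; lra).
  assert (Hbnd : forall y, x <= y <= PI -> Rabs (dg y) <= / (2 * n * s ^ 2)).
  { intros y Hy; unfold dg.
    pose proof (Hmon y ltac:(lra)) as Hsy.
    assert (Hsy2 : s ^ 2 <= sin (y / 2) ^ 2) by (apply pow_incr; lra).
    unfold Rdiv; rewrite !Rabs_mult, (Rabs_pos_eq (/ _)).
    2: { apply Rlt_le, Rinv_0_lt_compat; nra. }
    rewrite <- (Rmult_1_l (/ (2 * n * s ^ 2))).
    apply Rmult_le_compat.
    - rewrite <- Rabs_mult; apply Rabs_pos.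
    - apply Rlt_le, Rinv_0_lt_compat; nra.
    - rewrite <- (Rmult_1_l 1).
      apply Rmult_le_compat; try apply Rabs_pos; apply Rabs_cos_le_1.
    - apply Rinv_le_contravar; nra. }
  pose proof (increment_le _ dg x PI _ ltac:(lra) Hder Hbnd) as Hinc.
  cbv beta in Hinc.
  rewrite sawtooth_err_PI in Hinc.
  assert (HhPI : h PI = 0).
  { unfold h.
    replace ((INR N + / 2) * PI) with (PI / 2 + INR N * PI) by field.
    rewrite cos_plus, sin_INR_PI, cos_PI2; unfold Rdiv; ring. }
  rewrite HhPI in Hinc.
  assert (Hhx : Rabs (h x) <= / (n * s ^ 2)).
  { unfold h, Rdiv.
    pose proof (Hmon x ltac:(lra)) as Hsx.
    rewrite Rabs_mult, (Rabs_pos_eq (/ _)).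
    2: { apply Rlt_le, Rinv_0_lt_compat; nra. }
    rewrite <- (Rmult_1_l (/ (n * s ^ 2))).
    apply Rmult_le_compat; [apply Rabs_pos | | apply Rabs_cos_le_1 |].
    - apply Rlt_le, Rinv_0_lt_compat; nra.
    - apply Rinv_le_contravar; [nra|].
      apply Rmult_le_compat_l; [lra|]. nra. }
  set (q := / (n * s ^ 2)) in *.
  assert (Hq : 0 < q) by (apply Rinv_0_lt_compat; nra).
  replace (/ (2 * n * s ^ 2)) with (q / 2) in Hinc
    by (unfold q; field; lra).
  replace (3 / (n * s ^ 2)) with (3 * q) by (unfold q, Rdiv; reflexivity).
  assert (q / 2 * (PI - x) <= 2 * q) by nra.
  revert Hinc Hhx; unfold Rabs; repeat destruct Rcase_abs; lra.
Qed.

(** The new term is at most [1/(n+1)^2 <= 1/n - 1/(n+1)], which telescopes. *)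
Lemma parabola_err_tail (x : R) (N p : nat) :
  (1 <= N)%nat ->
  Rabs (parabola_err (N + p) x - parabola_err N x) <= / INR N - / INR (N + p).
Proof.
  intros HN; induction p as [|p IH].
  - rewrite Nat.add_0_r, !Rminus_diag, Rabs_R0; apply Rle_refl.
  - rewrite Nat.add_succ_r.
    set (n := (N + p)%nat) in *.
    assert (Hn : 0 < INR n) by (apply lt_0_INR; unfold n; lia).
    assert (E : parabola_err (S n) x - parabola_err N x
      = (parabola_err n x - parabola_err N x) + cos (INR (S n) * x) / INR (S n) ^ 2)
      by (unfold parabola_err; rewrite sum_n_m_1_S; ring).
    rewrite E.
    eapply Rle_trans; [apply Rabs_triang|].
    rewrite S_INR in *.
    assert (Hterm : Rabs (cos ((INR n + 1) * x) / (INR n + 1) ^ 2)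
                    <= / INR n - / (INR n + 1)).
    { apply Rle_trans with (/ (INR n + 1) ^ 2).
      - unfold Rdiv; rewrite Rabs_mult, (Rabs_pos_eq (/ _)).
        2: { apply Rlt_le, Rinv_0_lt_compat; nra. }
        rewrite <- (Rmult_1_l (/ (INR n + 1) ^ 2)) at 2.
        apply Rmult_le_compat_r; [|apply Rabs_cos_le_1].
        apply Rlt_le, Rinv_0_lt_compat; nra.
      - replace (/ INR n - / (INR n + 1)) with (/ (INR n * (INR n + 1)))
          by (field; lra).
        apply Rinv_le_contravar; nra. }
    lra.
Qed.

Lemma parabola_err_tail_le (x : R) (N n : nat) :
  (1 <= N)%nat -> (N <= n)%nat ->
  Rabs (parabola_err n x - parabola_err N x) <= / INR N.
Proof.
  intros HN Hn.
  pose proof (parabola_err_tail x N (n - N) HN) as H.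
  replace (N + (n - N))%nat with n in H by lia.
  assert (0 < / INR n) by (apply Rinv_0_lt_compat, lt_0_INR; lia).
  lra.
Qed.

Lemma parabola_err_0_cv : ex_finite_lim_seq (fun n => parabola_err n 0).
Proof.
  apply ex_lim_seq_cauchy_corr; intros eps.
  destruct (archimed_cor1 (eps / 2)) as [N [HN HN0]].
  { pose proof (cond_pos eps); lra. }
  exists N; intros n m Hn Hm.
  pose proof (parabola_err_tail_le 0 N n ltac:(lia) Hn) as H1.
  pose proof (parabola_err_tail_le 0 N m ltac:(lia) Hm) as H2.
  revert H1 H2; unfold Rabs; repeat destruct Rcase_abs; lra.
Qed.

(** On [d, PI] the increments of [F_N] are controlled by its derivative, the
    sawtooth error, and therefore tend to 0 with [N]. *)
Lemma parabola_err_increment_le (n : nat) (d x : R) :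
  0 < d -> d <= x <= PI ->
  Rabs (parabola_err n x - parabola_err n d)
    <= 3 / ((2 * INR n + 1) * sin (d / 2) ^ 2) * PI.
Proof.
  intros Hd Hx.
  set (K := 3 / ((2 * INR n + 1) * sin (d / 2) ^ 2)).
  assert (HK : forall y, d <= y <= PI -> Rabs (sawtooth_err n y) <= K)
    by (intros y Hy; apply sawtooth_err_bound; lra).
  assert (0 <= K) by (eapply Rle_trans; [apply Rabs_pos | apply (HK d); lra]).
  eapply Rle_trans.
  - apply (increment_le (parabola_err n) (sawtooth_err n) d x K); [lra | |].
    + intros; apply is_derive_parabola_err.
    + intros y Hy; apply HK; lra.
  - apply Rmult_le_compat_l; lra.
Qed.

Lemma continuous_parabola_err (N : nat) (x : R) : continuous (parabola_err N) x.
Proof.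
  apply (ex_derive_continuous (V := R_NormedModule)).
  exists (sawtooth_err N x); apply is_derive_parabola_err.
Qed.

Lemma continuous_at_0_right (f : R -> R) (e b : R) :
  continuous f 0 -> 0 < e -> 0 < b ->
  exists d, 0 < d <= b /\ Rabs (f d - f 0) < e.
Proof.
  intros Hf He Hb.
  destruct (proj1 (filterlim_locally f (f 0)) Hf (mkposreal e He)) as [r Hr].
  pose proof (cond_pos r) as Hr0.
  pose proof (Rmin_l (r / 2) b); pose proof (Rmin_r (r / 2) b).
  assert (0 < Rmin (r / 2) b) by (apply Rmin_glb_lt; lra).
  exists (Rmin (r / 2) b); split; [lra|].
  apply (Hr (Rmin (r / 2) b)).
  change (Rabs (Rmin (r / 2) b - 0) < r).
  rewrite Rabs_pos_eq; lra.
Qed.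

(** The limit is the same at [x] and at 0: an intermediate point [d] close to 0 is
    compared with 0 through a fixed [F_M], at the cost of two tails, and with [x]
    through the vanishing of the increments on [d, x]. *)
Lemma parabola_err_flat_limit (x : R) :
  0 <= x <= PI ->
  is_lim_seq (fun n => parabola_err n x - parabola_err n 0) 0.
Proof.
  intros Hx.
  destruct (Req_dec x 0) as [->|Hx0].
  { apply is_lim_seq_ext with (fun _ => 0); [intros; ring | apply is_lim_seq_const]. }
  apply is_lim_seq_spec; intros eps; pose proof (cond_pos eps) as He.
  (* Budget: eps/8 for each tail, eps/4 for the continuity of F_M at 0 and
     eps/4 for the increment between d and x. *)
  destruct (archimed_cor1 (eps / 8)) as [M [HM HM0]]; [lra|].
  destruct (continuous_at_0_right (parabola_err M) (eps / 4) x) as [d [Hd Hdc]];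
    [apply continuous_parabola_err | lra | lra |].
  pose proof PI_4.
  set (s := sin (d / 2)).
  assert (Hs : 0 < s) by (apply sin_gt_0; lra).
  assert (Hs2 : 0 < s ^ 2) by (apply pow_lt; exact Hs).
  destruct (archimed_cor1 (eps * s ^ 2 / 24)) as [Q [HQ HQ0]]; [nra|].
  exists (max M Q); intros n Hn.
  pose proof (parabola_err_tail_le d M n ltac:(lia) ltac:(lia)) as Td.
  pose proof (parabola_err_tail_le 0 M n ltac:(lia) ltac:(lia)) as T0.
  pose proof (parabola_err_increment_le n d x ltac:(lra) ltac:(lra)) as Ti.
  fold s in Ti.
  assert (HnQ : / INR n < eps * s ^ 2 / 24).
  { apply Rle_lt_trans with (2 := HQ).
    apply Rinv_le_contravar; [apply lt_0_INR; lia | apply le_INR; lia]. }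
  assert (Hn0 : 0 < INR n) by (apply lt_0_INR; lia).
  assert (Hsmall : 3 / ((2 * INR n + 1) * s ^ 2) * PI < eps / 4).
  (* Uses PI <= 4 and 2n + 1 >= 2n. *)
  { apply Rle_lt_trans with (6 * / INR n / s ^ 2).
    - replace (6 * / INR n / s ^ 2) with (3 / (2 * INR n * s ^ 2) * 4)
        by (field; lra).
      apply Rmult_le_compat; [|lra| |lra].
      + apply Rlt_le, Rdiv_lt_0_compat; nra.
      + apply Rmult_le_compat_l; [lra|].
        apply Rinv_le_contravar; nra.
    - apply Rmult_lt_reg_r with (s ^ 2); [exact Hs2|].
      replace (6 * / INR n / s ^ 2 * s ^ 2) with (6 * / INR n) by (field; lra).
      lra. }
  rewrite Rminus_0_r.
  revert Td T0 Ti Hdc; unfold Rabs; repeat destruct Rcase_abs; lra.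
Qed.

(** The sup-norm tail estimate that produces the factor [1/N] of the theorem:
    [C] is the common limit, and the tail bound passes to the limit. *)
Lemma parabola_fourier_remainder :
  exists C, forall (N : nat) (x : R), (1 <= N)%nat -> 0 <= x <= PI ->
    Rabs (parabola_err N x - C) <= / INR N.
Proof.
  destruct parabola_err_0_cv as [C HC].
  exists C; intros N x HN Hx.
  assert (Hl : is_lim_seq (fun n => parabola_err n x) C).
  { apply is_lim_seq_ext with
      (fun n => (parabola_err n x - parabola_err n 0) + parabola_err n 0);
      [intros; ring|].
    replace C with (0 + C) by ring.
    apply is_lim_seq_plus'; [apply parabola_err_flat_limit; exact Hx | exact HC]. }
  assert (Hd : is_lim_seq (fun p => Rabs (parabola_err (p + N) x - parabola_err N x))
                 (Rabs (C - parabola_err N x))).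
  { apply (is_lim_seq_abs _ (C - parabola_err N x)).
    apply is_lim_seq_minus'; [|apply is_lim_seq_const].
    apply (is_lim_seq_incr_n (fun n => parabola_err n x) N C); exact Hl. }
  rewrite Rabs_minus_sym.
  apply (is_lim_seq_le _ _ _ (/ INR N)) with (2 := Hd) (3 := is_lim_seq_const _).
  intros p; apply parabola_err_tail_le; lia.
Qed.

(** * Calculus with one-sided derivatives at the endpoints *)

(** Precomposing with [clamp] extends a function from [a, b] to the line by its
    end values.  The extension is continuous everywhere, but may fail to be
    differentiable at [a] and [b]. *)
Definition clamp (a b x : R) : R := Rmax a (Rmin x b).

Lemma clamp_in (a b x : R) : a <= b -> a <= clamp a b x <= b.
Proof.
  intros Hab; unfold clamp; split; [apply Rmax_l|].
  apply Rmax_lub; [exact Hab | apply Rmin_r].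
Qed.

Lemma clamp_id (a b x : R) : a <= x <= b -> clamp a b x = x.
Proof. intros Hx; unfold clamp; rewrite Rmin_left, Rmax_right; lra. Qed.

Lemma clamp_lipschitz (a b x y : R) :
  a <= b -> Rabs (clamp a b x - clamp a b y) <= Rabs (x - y).
Proof.
  intros Hab; unfold clamp, Rmax, Rmin.
  repeat destruct Rle_dec; unfold Rabs; repeat destruct Rcase_abs; lra.
Qed.

Lemma continuous_clamp_comp (f : R -> R) (a b : R) :
  a <= b -> continuous_on (fun s => a <= s <= b) f ->
  forall x, continuous (fun s => f (clamp a b s)) x.
Proof.
  intros Hab Hf x P HP.
  destruct (Hf (clamp a b x) (clamp_in a b x Hab) P HP) as [r Hr].
  exists r; intros y Hy.
  apply Hr; [|apply clamp_in; exact Hab].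
  apply Rle_lt_trans with (1 := clamp_lipschitz a b y x Hab); exact Hy.
Qed.

Lemma is_derive_within_continuous (D : R -> Prop) (f : R -> R) (x l : R) :
  is_derive_within D f x l -> filterlim f (within D (locally x)) (locally (f x)).
Proof.
  intros Hf.
  apply (filterdiff_continuous_aux (K := R_AbsRing) (U := R_NormedModule)
           (V := R_NormedModule) f).
  - exists (fun h => scal h l); exact Hf.
  - intros P HP; apply filter_le_within; exact HP.
Qed.

Lemma is_derive_clamp_comp (f : R -> R) (a b x l : R) :
  a < x < b -> is_derive_within (fun s => a <= s <= b) f x l ->
  is_derive (fun s => f (clamp a b s)) x l.
Proof.
  intros Hx [Hlin Hf].
  assert (Hin : locally x (fun y : R => a < y < b)).
  { apply (open_and (fun y => a < y) (fun y => y < b));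
      [apply open_gt | apply open_lt | exact Hx]. }
  apply is_derive_ext_loc with f.
  - apply filter_imp with (2 := Hin); intros y Hy.
    rewrite clamp_id by lra; reflexivity.
  - split; [exact Hlin|].
    intros y Hy eps.
    assert (Hy' : is_filter_lim (within (fun s => a <= s <= b) (locally x)) y).
    { intros P HP; apply filter_le_within, Hy, HP. }
    specialize (Hf y Hy' eps); unfold within in Hf.
    apply filter_imp with (2 := filter_and _ _ Hin Hf).
    intros z [Hz Hfz]; apply Hfz; lra.
Qed.

(** Fundamental theorem for a derivative known only on the open interval, as is
    the case for clamped functions: the difference between [f] and the primitive
    of [df] is continuous with zero derivative inside, so the mean value theorem
    makes it constant up to the endpoints. *)
Lemma RInt_derive_interior (f df : R -> R) (a b : R) :
  a <= b ->
  (forall x, continuous f x) -> (forall x, continuous df x) ->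
  (forall x, a < x < b -> is_derive f x (df x)) ->
  is_RInt df a b (f b - f a).
Proof.
  intros Hab Hf Hdf Hd.
  assert (Hex : forall y, is_RInt df a y (RInt df a y)).
  { intros y; apply (RInt_correct (V := R_CompleteNormedModule)).
    apply (ex_RInt_continuous (V := R_CompleteNormedModule)).
    intros; apply Hdf. }
  assert (HI : forall y, is_derive (fun z => RInt df a z) y (df y)).
  { intros y; apply (is_derive_RInt (V := R_NormedModule) df _ a); [|apply Hdf].
    apply filter_forall; exact Hex. }
  destruct (MVT_gen (fun y => RInt df a y - f y) a b (fun _ => 0)) as [c [_ E]];
    rewrite ?(Rmin_left _ _ Hab), ?(Rmax_right _ _ Hab) in *.
  - intros x Hx.
    replace 0 with (df x - df x) by ring.
    apply (is_derive_minus (V := R_NormedModule)); [apply HI | apply Hd; exact Hx].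
  - intros x _; apply continuity_pt_filterlim.
    apply (continuous_minus (V := R_NormedModule)); [|apply Hf].
    apply (ex_derive_continuous (V := R_NormedModule)).
    exists (df x); apply HI.
  - assert (E0 : RInt df a a = 0) by apply (RInt_point (V := R_CompleteNormedModule)).
    rewrite E0 in E.
    replace (f b - f a) with (RInt df a b) by lra.
    apply Hex.
Qed.

(** * Representation of the error and its estimate *)

Lemma kappa_dirichlet (tau k : R) (N : nat) (x : R) :
  0 < tau -> 2 * kappa tau k N x = 2 * k / tau * dirichlet N (omega0 tau * x).
Proof.
  intros Ht; unfold kappa, dirichlet.
  assert (E : sum_n_m (fun l => k / tau * cos (INR l * omega0 tau * x)) 1 N
    = k / tau * sum_n_m (fun l => cos (INR l * (omega0 tau * x))) 1 N).
  { rewrite <- (sum_n_m_mult_l (K := R_Ring)).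
    apply sum_n_m_ext; intros l.
    change (k / tau * cos (INR l * omega0 tau * x)
            = k / tau * cos (INR l * (omega0 tau * x))).
    rewrite Rmult_assoc; reflexivity. }
  rewrite E; field; lra.
Qed.

(** [k] minus the integral of [2 * kappa] from 0 to [x]: what the step response
    of [K_N] still lacks at time [x].  The Dirichlet kernel integrates to the
    sawtooth error, which gives this closed form. *)
Definition step_remainder (tau k : R) (N : nat) (x : R) : R :=
  2 * k / PI * sawtooth_err N (omega0 tau * x).

(** A primitive of [step_remainder]; the free constant [C] is what allows it to be
    small of order [1/N] instead of merely bounded. *)
Definition ramp_remainder (tau k : R) (N : nat) (C x : R) : R :=
  2 * k * tau / PI ^ 2 * (parabola_err N (omega0 tau * x) - C).

Lemma step_remainder_0 (tau k : R) (N : nat) : step_remainder tau k N 0 = k.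
Proof.
  pose proof PI_RGT_0.
  unfold step_remainder, sawtooth_err.
  rewrite (sum_n_m_ext_loc _ (fun _ => 0)).
  - rewrite sum_n_m_const; field; lra.
  - intros l _; rewrite !Rmult_0_r, sin_0; apply Rdiv_0_l.
Qed.

Lemma is_derive_step_remainder_rev (tau k : R) (N : nat) (t s : R) :
  0 < tau ->
  is_derive (fun s => step_remainder tau k N (t - s)) s (2 * kappa tau k N (t - s)).
Proof.
  intros Ht; pose proof PI_RGT_0.
  rewrite kappa_dirichlet by exact Ht.
  set (w := omega0 tau).
  assert (Hin : is_derive (fun s => w * (t - s)) s (- w)).
  { auto_derive; [trivial | eqR; ring]. }
  pose proof (is_derive_comp (V := R_NormedModule) _ _ s _ _
                (is_derive_sawtooth_err N (w * (t - s))) Hin) as Hc.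
  pose proof (is_derive_scal _ s (2 * k / PI) _ Hc) as Hs.
  replace (2 * k / tau * dirichlet N (w * (t - s)))
    with (2 * k / PI * (- w * - dirichlet N (w * (t - s))))
    by (unfold w, omega0; field; lra).
  exact Hs.
Qed.

Lemma is_derive_ramp_remainder_rev (tau k : R) (N : nat) (C t s : R) :
  0 < tau ->
  is_derive (fun s => ramp_remainder tau k N C (t - s)) s
    (- step_remainder tau k N (t - s)).
Proof.
  intros Ht; pose proof PI_RGT_0.
  unfold step_remainder, ramp_remainder; set (w := omega0 tau).
  assert (Hin : is_derive (fun s => w * (t - s)) s (- w)).
  { auto_derive; [trivial | eqR; ring]. }
  pose proof (is_derive_comp (V := R_NormedModule) _ _ s _ _
                (is_derive_parabola_err N (w * (t - s))) Hin) as Hc.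
  pose proof (is_derive_minus (V := R_NormedModule) _ _ s _ _ Hc
                (is_derive_const C s)) as Hm.
  pose proof (is_derive_scal _ s (2 * k * tau / PI ^ 2) _ Hm) as Hs.
  replace (- (2 * k / PI * sawtooth_err N (w * (t - s))))
    with (2 * k * tau / PI ^ 2 * (- w * sawtooth_err N (w * (t - s)) - 0))
    by (unfold w, omega0; field; lra).
  exact Hs.
Qed.

Lemma continuous_kappa_rev (tau k : R) (N : nat) (t s : R) :
  0 < tau -> continuous (fun s => 2 * kappa tau k N (t - s)) s.
Proof.
  intros Ht.
  apply continuous_ext with
    (fun s => 2 * k / tau * dirichlet N (omega0 tau * (t - s))).
  { intros y; symmetry; apply kappa_dirichlet; exact Ht. }
  apply (ex_derive_continuous (V := R_NormedModule)).
  unfold dirichlet.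
  apply ex_derive_scal.
  apply (ex_derive_plus (V := R_NormedModule)); [apply ex_derive_const|].
  eexists.
  apply (is_derive_sum_1 (fun l y => cos (INR l * (omega0 tau * (t - y))))
    (fun l y => INR l * omega0 tau * sin (INR l * (omega0 tau * (t - y))))).
  intros l _; auto_derive; [trivial | eqR; unfold Rminus; ring].
Qed.

(** Two integrations by parts done at once: the function
    [Phi (t - s) u (s) + Psi (t - s) u' (s)] is differentiated, the terms
    [Phi u'] cancel, and what is left is the integrand of [K_op] plus
    [Psi u'']. *)
Lemma error_representation (tau k C : R) (N : nat) (u du ddu : R -> R) (t : R) :
  0 < tau -> is_C2_on 0 tau u du ddu -> u 0 = 0 -> 0 <= t <= tau ->
  is_RInt (fun s => ramp_remainder tau k N C (t - s) * ddu s) 0 t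
    (k * u t - K_op tau k N u t
     + ramp_remainder tau k N C 0 * du t - ramp_remainder tau k N C t * du 0).
Proof.
  intros Htau [Hd Hddu] Hu0 Ht.
  set (Phi := step_remainder tau k N).
  set (Psi := ramp_remainder tau k N C).
  (* The derivatives of u at 0 and tau are one-sided, so everything is done with
     clamped copies, which are continuous on the whole line. *)
  set (U := fun s => u (clamp 0 tau s)).
  set (U1 := fun s => du (clamp 0 tau s)).
  set (U2 := fun s => ddu (clamp 0 tau s)).
  assert (Hle : 0 <= tau) by lra.
  assert (cU : forall x, continuous U x).
  { apply continuous_clamp_comp; [exact Hle|]; intros x Hx.
    apply is_derive_within_continuous with (1 := proj1 (Hd x Hx)). }
  assert (cU1 : forall x, continuous U1 x).
  { apply continuous_clamp_comp; [exact Hle|]; intros x Hx.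
    apply is_derive_within_continuous with (1 := proj2 (Hd x Hx)). }
  assert (cU2 : forall x, continuous U2 x)
    by (apply continuous_clamp_comp; [exact Hle | exact Hddu]).
  assert (cPhi : forall s, continuous (fun s => Phi (t - s)) s).
  { intros s; apply (ex_derive_continuous (V := R_NormedModule)).
    eexists; apply is_derive_step_remainder_rev; exact Htau. }
  assert (cPsi : forall s, continuous (fun s => Psi (t - s)) s).
  { intros s; apply (ex_derive_continuous (V := R_NormedModule)).
    eexists; apply is_derive_ramp_remainder_rev; exact Htau. }
  assert (ckU : forall s, continuous (fun s => 2 * kappa tau k N (t - s) * U s) s).
  { intros s; apply (continuous_mult (K := R_AbsRing)); [|apply cU].
    apply continuous_kappa_rev; exact Htau. }
  assert (cPU2 : forall s, continuous (fun s => Psi (t - s) * U2 s) s)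
    by (intros s; apply (continuous_mult (K := R_AbsRing)); auto).
  assert (HW : is_RInt
    (fun s => 2 * kappa tau k N (t - s) * U s + Psi (t - s) * U2 s) 0 t
    ((Phi (t - t) * U t + Psi (t - t) * U1 t)
     - (Phi (t - 0) * U 0 + Psi (t - 0) * U1 0))).
  { apply (RInt_derive_interior (fun s => Phi (t - s) * U s + Psi (t - s) * U1 s)).
    - lra.
    - intros s; apply (continuous_plus (V := R_NormedModule));
        apply (continuous_mult (K := R_AbsRing)); auto.
    - intros s; apply (continuous_plus (V := R_NormedModule)); auto.
    - intros s Hs.
      destruct (Hd s ltac:(lra)) as [Hu1 Hu2].
      assert (dU : is_derive U s (U1 s)).
      { unfold U1; rewrite clamp_id by lra.
        apply is_derive_clamp_comp; [lra | exact Hu1]. }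
      assert (dU1 : is_derive U1 s (U2 s)).
      { unfold U2; rewrite clamp_id by lra.
        apply is_derive_clamp_comp; [lra | exact Hu2]. }
      pose proof (is_derive_mult _ _ s _ _
        (is_derive_step_remainder_rev tau k N t s Htau) dU Rmult_comm) as D1.
      pose proof (is_derive_mult _ _ s _ _
        (is_derive_ramp_remainder_rev tau k N C t s Htau) dU1 Rmult_comm) as D2.
      pose proof (is_derive_plus (V := R_NormedModule) _ _ s _ _ D1 D2) as D.
      replace (2 * kappa tau k N (t - s) * U s + Psi (t - s) * U2 s)
        with ((2 * kappa tau k N (t - s) * U s + Phi (t - s) * U1 s)
              + (- Phi (t - s) * U1 s + Psi (t - s) * U2 s)) by ring.
      exact D. }
  assert (HK : is_RInt (fun s => 2 * kappa tau k N (t - s) * U s) 0 t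
                 (K_op tau k N u t)).
  { unfold K_op.
    rewrite (RInt_ext _ (fun s => 2 * kappa tau k N (t - s) * U s)).
    - apply (RInt_correct (V := R_CompleteNormedModule)).
      apply (ex_RInt_continuous (V := R_CompleteNormedModule)); auto.
    - rewrite Rmin_left, Rmax_right by lra; intros s Hs.
      unfold causal, U; rewrite clamp_id by lra.
      destruct Rle_dec; [reflexivity | lra]. }
  pose proof (is_RInt_minus (V := R_NormedModule) _ _ _ _ _ _ HW HK) as HD.
  rewrite Rminus_diag, Rminus_0_r in HD; unfold U, U1 in HD.
  rewrite !clamp_id, Hu0 in HD by lra.
  unfold Phi in HD; rewrite step_remainder_0 in HD; fold Phi in HD.
  replace (k * u t - K_op tau k N u t + Psi 0 * du t - Psi t * du 0)
    with (k * u t + Psi 0 * du t - (Phi t * 0 + Psi t * du 0) - K_op tau k N u t)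
    by ring.
  apply is_RInt_ext with (2 := HD).
  rewrite Rmin_left, Rmax_right by lra; intros s Hs.
  unfold U2; rewrite clamp_id by lra.
  change ((2 * kappa tau k N (t - s) * u s + Psi (t - s) * ddu s)
    - 2 * kappa tau k N (t - s) * u s = Psi (t - s) * ddu s).
  ring.
Qed.

(** One constant serves all parameters, since rescaling by [omega0] always leads to
    the same Fourier remainder on [0, PI]. *)
Lemma ramp_remainder_bound :
  exists C, forall (tau k : R) (N : nat) (x : R),
    0 < tau -> 0 < k -> (1 <= N)%nat -> 0 <= x <= tau ->
    Rabs (ramp_remainder tau k N C x) <= 2 * k * tau / (PI ^ 2 * INR N).
Proof.
  destruct parabola_fourier_remainder as [C HC].
  exists C; intros tau k N x Htau Hk HN Hx.
  pose proof PI_RGT_0 as HPI.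
  assert (0 < INR N) by (apply lt_0_INR; lia).
  assert (Hc : 0 < 2 * k * tau / PI ^ 2)
    by (apply Rdiv_lt_0_compat; [|apply pow_lt]; nra).
  unfold ramp_remainder; rewrite Rabs_mult, (Rabs_pos_eq _ (Rlt_le _ _ Hc)).
  replace (2 * k * tau / (PI ^ 2 * INR N)) with (2 * k * tau / PI ^ 2 * / INR N)
    by (field; lra).
  apply Rmult_le_compat_l; [lra|].
  apply HC; [exact HN|].
  unfold omega0; replace (PI / tau * x) with (PI * (x / tau)) by (field; lra).
  assert (0 <= x / tau <= 1).
  { split; [apply Rdiv_le_0_compat; lra|].
    apply Rmult_le_reg_r with tau; [lra|].
    replace (x / tau * tau) with x by (field; lra); lra. }
  nra.
Qed.

Lemma continuous_on_ex_RInt (f : R -> R) (a b c : R) :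
  a <= c <= b -> continuous_on (fun s => a <= s <= b) f -> ex_RInt f a c.
Proof.
  intros Hc Hf.
  apply ex_RInt_ext with (fun s => f (clamp a b s)).
  - rewrite Rmin_left, Rmax_right by lra; intros x Hx.
    rewrite clamp_id by lra; reflexivity.
  - apply (ex_RInt_continuous (V := R_CompleteNormedModule)); intros.
    apply continuous_clamp_comp; [lra | exact Hf].
Qed.

Lemma is_RInt_mult_bound (g f : R -> R) (a b M I : R) :
  a <= b -> (forall s, a < s < b -> Rabs (g s) <= M) -> ex_RInt f a b ->
  is_RInt (fun s => g s * f s) a b I ->
  Rabs I <= M * L1_norm a b f.
Proof.
  intros Hab Hg Hf HI.
  assert (Hex : ex_RInt (fun s => g s * f s) a b) by (exists I; exact HI).
  assert (Hnf : ex_RInt (fun s => Rabs (f s)) a b)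
    by (apply ex_RInt_norm; exact Hf).
  rewrite <- (is_RInt_unique (V := R_CompleteNormedModule) _ _ _ _ HI).
  eapply Rle_trans; [apply abs_RInt_le; [exact Hab | exact Hex]|].
  unfold L1_norm.
  assert (E : RInt (fun s => M * Rabs (f s)) a b = M * RInt (fun s => Rabs (f s)) a b)
    by exact (RInt_scal (V := R_CompleteNormedModule) _ a b M Hnf).
  rewrite <- E.
  apply RInt_le; [exact Hab | | |].
  - apply ex_RInt_norm; exact Hex.
  - apply (ex_RInt_scal (V := R_NormedModule)); exact Hnf.
  - intros s Hs; rewrite Rabs_mult.
    apply Rmult_le_compat_r; [apply Rabs_pos | apply Hg; exact Hs].
Qed.

Theorem proposition1 (tau k : R) (N : nat) (u du ddu : R -> R)
    (htau : 0 < tau) (hk : 0 < k) (hN : (1 <= N)%nat)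
    (hu : is_C2_on 0 tau u du ddu) (hu0 : u 0 = 0) :
  let y := fun t => k * u t in
  let yN := K_op tau k N u in
  forall t, 0 <= t <= tau ->
    Rabs (y t - yN t) <=
      2 * k * tau / (PI ^ 2 * INR N) *
        (Rabs (du t) + Rabs (du 0) + L1_norm 0 t ddu).
Proof.
  intros y yN t Ht; unfold y, yN.
  destruct ramp_remainder_bound as [C HC].
  pose proof (error_representation tau k C N u du ddu t htau hu hu0 Ht) as HI.
  set (M := 2 * k * tau / (PI ^ 2 * INR N)).
  set (Psi := ramp_remainder tau k N C) in *.
  assert (HPsi : forall x, 0 <= x <= tau -> Rabs (Psi x) <= M)
    by (intros x Hx; apply HC; assumption).
  apply is_RInt_mult_bound with (M := M) in HI.
  - assert (H0 : Rabs (Psi 0 * du t) <= M * Rabs (du t)).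
    { rewrite Rabs_mult; apply Rmult_le_compat_r;
        [apply Rabs_pos | apply HPsi; lra]. }
    assert (H1 : Rabs (Psi t * du 0) <= M * Rabs (du 0)).
    { rewrite Rabs_mult; apply Rmult_le_compat_r;
        [apply Rabs_pos | apply HPsi; lra]. }
    rewrite !Rmult_plus_distr_l.
    apply Rabs_le_between in H0, H1, HI; apply Rabs_le; lra.
  - lra.
  - intros s Hs; apply HPsi; lra.
  - apply continuous_on_ex_RInt with tau; [exact Ht | exact (proj2 hu)].
Qed.
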